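(* Let $m,n$ be arbitrary non-negative integers and let $\tau$ be a Hausdorff topology on $\mathscr{C}_{m,n}$ such that $(\mathscr{C}_{m,n},\tau)$ is a semitopological semigroup. Then $\tau$ is the discrete topology.
   Context: The bicyclic monoid $\mathscr{C}(p,q)$ is the monoid with identity $1$ generated by two elements $p,q$ subject only to the relation $pq=1$. Each of its elements is written uniquely as $q^ip^j$ with $i,j\in\mathbb{N}_0$ (non-negative integers). For fixed $m,n\in\mathbb{N}_0$, $\mathscr{C}_{m,n}$ denotes the semigroup $(\mathscr{C}(p,q),\ast_{m,n})$ with the same underlying set and with operation $a\ast_{m,n}b=a\,q^mp^n\,b$ (product on the right taken in $\mathscr{C}(p,q)$). A semitopological semigroup is a topological space with a separately continuous semigroup operation. *)

(* Defs.v *)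
From HB Require Import structures.
From mathcomp Require Import all_boot.
From mathcomp Require Import boolp classical_sets functions filter topology.

Set Implicit Arguments.
Unset Strict Implicit.
Unset Printing Implicit Defensive.

Local Open Scope group_scope.

(* The free monoid on {p, q} is [seq bool], with [true] the letter p and
   [false] the letter q; [bicyclic_cong] is the congruence generated by
   pq = 1. *)
Inductive bicyclic_cong : seq bool -> seq bool -> Prop :=
| bicyclic_cong_pq : bicyclic_cong [:: true; false] [::]
| bicyclic_cong_refl u : bicyclic_cong u u
| bicyclic_cong_sym u v : bicyclic_cong u v -> bicyclic_cong v u
| bicyclic_cong_trans v u w :
    bicyclic_cong u v -> bicyclic_cong v w -> bicyclic_cong u w
| bicyclic_cong_cat u u' v v' :
    bicyclic_cong u u' -> bicyclic_cong v v' ->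
    bicyclic_cong (u ++ v) (u' ++ v').

Definition bicyclic_eqv : rel (seq bool) := fun u v => `[< bicyclic_cong u v >].

Lemma bicyclic_eqv_refl : reflexive bicyclic_eqv.
Proof. by move=> u; apply/asboolP; exact: bicyclic_cong_refl. Qed.

Lemma bicyclic_eqv_sym : symmetric bicyclic_eqv.
Proof. by move=> u v; apply/asboolP/asboolP; exact: bicyclic_cong_sym. Qed.

Lemma bicyclic_eqv_trans : transitive bicyclic_eqv.
Proof.
move=> v u w /asboolP uv /asboolP vw; apply/asboolP.
exact: bicyclic_cong_trans uv vw.
Qed.

Canonical bicyclic_equiv :=
  EquivRel bicyclic_eqv bicyclic_eqv_refl bicyclic_eqv_sym bicyclic_eqv_trans.

Definition bicyclic : Type := {eq_quot bicyclic_equiv}%qT.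

HB.instance Definition _ := Choice.on bicyclic.

Definition bicyclic_of (u : seq bool) : bicyclic :=
  \pi_({eq_quot bicyclic_equiv})%qT u.

Lemma bicyclic_ofP u v : bicyclic_of u = bicyclic_of v <-> bicyclic_cong u v.
Proof.
split=> [/eqP|uv]; first by rewrite eqmodE => /asboolP.
by apply/eqP; rewrite eqmodE; apply/asboolP.
Qed.

Lemma bicyclic_of_repr (x : bicyclic) : bicyclic_of (repr x) = x.
Proof. exact: reprK. Qed.

Definition bicyclic_mul (x y : bicyclic) : bicyclic :=
  bicyclic_of (repr x ++ repr y).

Lemma bicyclic_ofM u v :
  bicyclic_mul (bicyclic_of u) (bicyclic_of v) = bicyclic_of (u ++ v).
Proof.
by apply/bicyclic_ofP; apply: bicyclic_cong_cat; apply/bicyclic_ofP;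
  exact: bicyclic_of_repr.
Qed.

Lemma bicyclic_mulA : associative bicyclic_mul.
Proof.
move=> x y z.
rewrite -(bicyclic_of_repr x) -(bicyclic_of_repr y) -(bicyclic_of_repr z).
by rewrite !bicyclic_ofM catA.
Qed.

Lemma bicyclic_mul1g : left_id (bicyclic_of [::]) bicyclic_mul.
Proof. by move=> x; rewrite -(bicyclic_of_repr x) bicyclic_ofM. Qed.

Lemma bicyclic_mulg1 : right_id (bicyclic_of [::]) bicyclic_mul.
Proof. by move=> x; rewrite -(bicyclic_of_repr x) bicyclic_ofM cats0. Qed.

HB.instance Definition _ :=
  isMonoid.Build bicyclic bicyclic_mulA bicyclic_mul1g bicyclic_mulg1.

Definition bp : bicyclic := bicyclic_of [:: true].
Definition bq : bicyclic := bicyclic_of [:: false].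

Lemma bp_bq : bp * bq = 1.
Proof.
rewrite [LHS]bicyclic_ofM; apply/bicyclic_ofP; exact: bicyclic_cong_pq.
Qed.

(* q acts on [nat] as the successor and p as the predecessor. *)
Definition bicyclic_act (u : seq bool) (x : nat) : nat :=
  foldr (fun l y => if l then y.-1 else y.+1) x u.

Lemma bicyclic_act_cong u v :
  bicyclic_cong u v -> forall x, bicyclic_act u x = bicyclic_act v x.
Proof.
elim=> {u v} // [u v w _ IH1 _ IH2 x|u u' v v' _ IH1 _ IH2 x].
- by rewrite IH1.
- by rewrite /bicyclic_act !foldr_cat -!/(bicyclic_act _ _) IH2 IH1.
Qed.

Lemma bicyclic_ofX l k : bicyclic_of [:: l] ^+ k = bicyclic_of (nseq k l).
Proof.
elim: k => // k IH; rewrite expgS IH; exact: (bicyclic_ofM [:: l]).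
Qed.

Lemma bicyclic_normal_form (x : bicyclic) :
  exists! ij : nat * nat, x = bq ^+ ij.1 * bp ^+ ij.2.
Proof.
have nfE i j : bq ^+ i * bp ^+ j = bicyclic_of (nseq i false ++ nseq j true).
  by rewrite !bicyclic_ofX; exact: bicyclic_ofM.
have actE i j y : bicyclic_act (nseq i false ++ nseq j true) y = y - j + i.
  rewrite /bicyclic_act foldr_cat.
  have -> : foldr (fun l y => if l then y.-1 else y.+1) y (nseq j true) = y - j.
    by elim: j => [|j /= ->]; rewrite ?subn0 // subnS.
  by elim: i => [|i /= ->]; rewrite ?addn0 // addnS.
have [[i j] ->] : exists ij : nat * nat, x = bq ^+ ij.1 * bp ^+ ij.2.
  rewrite -(bicyclic_of_repr x); elim: (repr x) => [|l u [[i j] /= E]].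
    by exists (0, 0).
  rewrite -[l :: u]/([:: l] ++ u) -bicyclic_ofM E.
  case: l; last by exists (i.+1, j); rewrite expgS -mulgA.
  case: i {E} => [|i]; first by exists (0, j.+1); rewrite /= !mul1g expgS.
  exists (i, j); rewrite expgS -!mulgA.
  by rewrite [LHS](mulgA bp bq) bp_bq mul1g.
exists (i, j); split=> // -[i' j'] /=; rewrite !nfE => /bicyclic_ofP.
move=> /bicyclic_act_cong E.
have Ei := E 0; rewrite !actE !sub0n !add0n in Ei.
have Ej := E (maxn j j'); rewrite !actE Ei in Ej.
move/addIn: Ej => Ej; congr pair; first by [].
by rewrite -(subKn (leq_maxl j j')) Ej subKn ?leq_maxr.
Qed.

Definition interassociate_mul (m n : nat) (a b : bicyclic) : bicyclic :=
  a * (bq ^+ m * bp ^+ n) * b.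

Lemma interassociate_mulA m n : associative (interassociate_mul m n).
Proof. by move=> a b c; rewrite /interassociate_mul !mulgA. Qed.

(* The parameters matter only for the product: this alias keeps that product
   apart from the one of [bicyclic]. *)
Definition interassociate (m n : nat) : Type := bicyclic.

HB.instance Definition _ m n := Choice.copy (interassociate m n) bicyclic.
HB.instance Definition _ m n :=
  isSemigroup.Build (interassociate m n) (@interassociate_mulA m n).

Local Open Scope classical_set_scope.

(* A topology on the carrier of [S] is an inhabitant of the class
   [Topological] over it; [Topological.Pack tau] is the resulting space. *)
Definition semitopological (S : semigroupType) (tau : Topological S) : Prop :=
  let T := Topological.Pack tau in
  forall a : S,
    continuous ((fun x : S => a * x) : T -> T) /\
    continuous ((fun x : S => x * a) : T -> T).

(* Main.v *)
Require Import Defs.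
From mathcomp Require Import all_boot.
From mathcomp Require Import boolp classical_sets functions filter topology.
From mathcomp Require Import zify cardinality.

(** For a = q^(n+N) p^(m+N), left (right) multiplication by a in C_{m,n} is
    multiplication in C(p,q) by the idempotent q^(n+N) p^(n+N)
    (resp. q^(m+N) p^(m+N)), so a point q^i p^j is fixed iff n+N <= i
    (resp. m+N <= j). Fixed-point sets of continuous maps of a Hausdorff space
    are closed; hence the points fixed by neither map form an open set, which
    is finite and contains any prescribed point once N is large. A Hausdorff
    space covered by finite open sets is discrete. *)

Set Implicit Arguments.
Unset Strict Implicit.
Unset Printing Implicit Defensive.

Local Open Scope group_scope.
Local Open Scope classical_set_scope.

Lemma closed_equalizer (T U : topologicalType) (f g : T -> U) :
  hausdorff_space U -> continuous f -> continuous g ->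
  closed [set x | f x = g x].
Proof.
rewrite open_hausdorff => hU cf cg; rewrite -openC openE => x /= /eqP fgx.
have [[A B] /= [fA gB] [oA oB /eqP AB0]] := hU _ _ fgx.
(* For [y] near [x], a common value [f y = g y] would lie in both disjoint sets [A] and [B]. *)
rewrite /interior; near=> y => /= fgy.
suff: (A `&` B) (f y) by rewrite AB0.
split; last rewrite fgy; near: y.
- by apply: cf; apply: open_nbhs_nbhs; split=> //; rewrite inE in fA.
- by apply: cg; apply: open_nbhs_nbhs; split=> //; rewrite inE in gB.
Unshelve. all: by end_near. Qed.

(** The rest of [U] is finite, hence closed, and can be removed from [U]. *)
Lemma accessible_open_set1 (T : topologicalType) (U : set T) (x : T) :
  accessible_space T -> open U -> finite_set U -> U x -> open [set x].
Proof.
move=> /accessible_finite_set_closed cT oU fU Ux.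
have -> : [set x] = U `&` ~` (U `\ x).
  apply/seteqP; split=> [y ->|y [Uy nUy]]; first by split=> // -[_ /(_ erefl)].
  by apply: contrapT => yx; apply: nUy.
by apply: openI => //; rewrite openC; apply: cT; exact: finite_setD.
Qed.

(** Inner pairs [bp * bq] cancel until one power is used up; truncated subtraction covers both
    cases. *)
Lemma bpX_mul_bqX (k l : nat) : bp ^+ k * bq ^+ l = bq ^+ (l - k) * bp ^+ (k - l).
Proof.
elim: k l => [|k IH] [|l]; rewrite ?subn0 ?sub0n ?mulg1 ?mul1g //.
by rewrite subSS expgSr expgS mulgA -(mulgA (bp ^+ k)) bp_bq mulg1 IH.
Qed.

Lemma bicyclic_nf_mul (i j k l : nat) :
  bq ^+ i * bp ^+ j * (bq ^+ k * bp ^+ l) =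
  bq ^+ (i + (k - j)) * bp ^+ (j - k + l).
Proof. by rewrite mulgA -(mulgA (bq ^+ i)) bpX_mul_bqX !expgnDr !mulgA. Qed.

Lemma bicyclic_nf_inj (i j k l : nat) :
  bq ^+ i * bp ^+ j = bq ^+ k * bp ^+ l -> i = k /\ j = l.
Proof.
move=> E; have [ij [_ ijU]] := bicyclic_normal_form (bq ^+ i * bp ^+ j).
by have := ijU (i, j) erefl; rewrite (ijU (k, l) E) => -[-> ->].
Qed.

Section InterassociateFixedPoints.
Variables (m n N : nat).
Let a : interassociate m n := bq ^+ (n + N) * bp ^+ (m + N).

Lemma interassociate_fixl (i j : nat) (x : interassociate m n) :
  x = bq ^+ i * bp ^+ j -> a * x = x <-> n + N <= i.
Proof.
move=> ->; rewrite [a * _]/(interassociate_mul m n _ _) /interassociate_mul.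
(* The product has [bq]-exponent max(n+N, i) and [bp]-exponent j plus the truncated difference (n+N)
   - i. *)
rewrite !bicyclic_nf_mul; split=> [/bicyclic_nf_inj[]|]; first by lia.
by move=> Ni; congr (bq ^+ _ * bp ^+ _); lia.
Qed.

Lemma interassociate_fixr (i j : nat) (x : interassociate m n) :
  x = bq ^+ i * bp ^+ j -> x * a = x <-> m + N <= j.
Proof.
move=> ->; rewrite [_ * a]/(interassociate_mul m n _ _) /interassociate_mul.
rewrite -mulgA !bicyclic_nf_mul; split=> [/bicyclic_nf_inj[]|]; first by lia.
by move=> Nj; congr (bq ^+ _ * bp ^+ _); lia.
Qed.

Lemma interassociate_nonfixed_finite :
  finite_set [set x : interassociate m n | a * x <> x /\ x * a <> x].
Proof.
(* Exponents of a nonfixed point lie in the box i < n+N, j < m+N. *)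
apply: (sub_finite_set _ (finite_image2 (fun i j => bq ^+ i * bp ^+ j)
  (finite_II (n + N)) (finite_II (m + N)))) => x /= [ax xa].
have [[i j] [/= xE _]] := bicyclic_normal_form x.
exists i; first by rewrite /= ltnNge; apply/negP => /(interassociate_fixl xE).
by exists j; first by rewrite /= ltnNge; apply/negP => /(interassociate_fixr xE).
Qed.

End InterassociateFixedPoints.

Theorem theorem3 (m n : nat) (tau : Topological (interassociate m n)) :
  hausdorff_space (Topological.Pack tau) ->
  semitopological (S := interassociate m n) tau ->
  forall A : set (Topological.Pack tau), open A.
Proof.
move=> hT cT A; set T := Topological.Pack tau in hT cT A *.
suff o1 (x : T) : open [set x].
  by rewrite -[A]image_id -bigcup_imset1; exact: bigcup_open.
have [[i j] [/= xE _]] := bicyclic_normal_form x.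
(* [N] exceeds both [i] and [j], so neither translation fixes [x], whatever [m] and [n] are. *)
pose N := (i + j).+1.
pose a : interassociate m n := bq ^+ (n + N) * bp ^+ (m + N).
have [cl cr] := cT a.
have cid : continuous (id : T -> T) by move=> y.
apply: (accessible_open_set1 (hausdorff_accessible hT) _
  (interassociate_nonfixed_finite m n N)).
- apply: openI; rewrite openC.
  + exact: (closed_equalizer hT cl cid).
  + exact: (closed_equalizer hT cr cid).
- by split=> [/(interassociate_fixl N xE)|/(interassociate_fixr N xE)];
    rewrite /N; lia.
Qed.
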